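(* Let $n\ge1$. If $\mathcal F_n\equiv\widehat{\mathcal F_n}$ (elementary equivalence in the language of Heyting algebras), then $\mathcal F_n\preccurlyeq\widehat{\mathcal F_n}$ (i.e. $\mathcal F_n$ is an elementary substructure of $\widehat{\mathcal F_n}$).
   Context: Fix $n\ge1$ and symbols $P_1,\dots,P_n$. The partially ordered set $(K_n,\le)$ with valuation map $\mathrm{val}:K_n\to\mathfrak P(\{P_1,\dots,P_n\})$ is the increasing union of finite sets $K_n^d$ ($d\ge 0$) built recursively: $K_n^{-1}=\emptyset$, and $K_n^d\setminus K_n^{d-1}$ consists of exactly one point $w_{\beta,Y}$ for each pair $(\beta,Y)$ such that (i) $Y$ is a decreasing subset of $K_n^{d-1}$ with $Y\not\subseteq K_n^{d-2}$ (for $d=0$ this last condition is void, so $Y=\emptyset$); (ii) $\beta\subseteq\{P_1,\dots,P_n\}$ and $\beta\subseteq\mathrm{val}(w')$ for all $w'\in Y$; (iii) if $Y$ is the decreasing set generated by a single element $w_{\beta',Y'}$, then $\beta\ne\beta'$. One sets $\mathrm{val}(w_{\beta,Y})=\beta$, and $w\le w_{\beta,Y}$ iff $w\in Y$ or $w=w_{\beta,Y}$. $\widehat{\mathcal F_n}:=\mathcal O_\downarrow(K_n,\le)$ is the Heyting algebra of all decreasing subsets of $K_n$ ($\sqcap=\cap$, $\sqcup=\cup$, $a\to b$ = the largest decreasing set contained in $(K_n\setminus a)\cup b$). By a theorem of Bellissima, the Heyting sub-algebra of $\widehat{\mathcal F_n}$ generated by $g_i=\{w\in K_n: P_i\in\mathrm{val}(w)\}$,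 $i=1,\dots,n$, is free on $g_1,\dots,g_n$; the free Heyting algebra $\mathcal F_n$ is identified with it. The language of Heyting algebras is $\mathcal L_{HA}=\{0,1,\sqcap,\sqcup,\to\}$. *)

(* Defs.v *)
From HB Require Import structures.
From mathcomp Require Import all_boot all_order.
From mathcomp Require Import finmap.
From mathcomp Require Import mathcomp_extra boolp classical_sets.

Set Implicit Arguments.
Unset Strict Implicit.
Unset Printing Implicit Defensive.

Local Open Scope classical_set_scope.

(* L_HA is the language {0, 1, meet, join, ->} of Heyting algebras; no Heyting
   algebra axiom is imposed on an arbitrary L_HA-structure. *)

Record LHA_structure := MkLHA {
  carrier :> Type;
  bot : carrier;
  top : carrier;
  meet : carrier -> carrier -> carrier;
  join : carrier -> carrier -> carrier;
  imp : carrier -> carrier -> carrier }.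

Inductive term : Type :=
  | TVar of nat
  | TBot
  | TTop
  | TMeet of term & term
  | TJoin of term & term
  | TImp of term & term.

Inductive formula : Type :=
  | FEq of term & term
  | FNot of formula
  | FAnd of formula & formula
  | FOr of formula & formula
  | FImp of formula & formula
  | FAll of nat & formula
  | FEx of nat & formula.

Fixpoint tvars (t : term) : seq nat :=
  match t with
  | TVar i => [:: i]
  | TBot | TTop => [::]
  | TMeet s u | TJoin s u | TImp s u => tvars s ++ tvars u
  end.

Fixpoint free_vars (f : formula) : seq nat :=
  match f with
  | FEq s t => tvars s ++ tvars t
  | FNot g => free_vars g
  | FAnd g h | FOr g h | FImp g h => free_vars g ++ free_vars h
  | FAll i g | FEx i g => [seq j <- free_vars g | j != i]
  end.

Definition sentence (f : formula) : Prop := free_vars f = [::].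

Fixpoint teval (M : LHA_structure) (e : nat -> M) (t : term) : M :=
  match t with
  | TVar i => e i
  | TBot => bot M
  | TTop => top M
  | TMeet s u => meet (teval e s) (teval e u)
  | TJoin s u => join (teval e s) (teval e u)
  | TImp s u => imp (teval e s) (teval e u)
  end.

Definition upd (T : Type) (e : nat -> T) (i : nat) (x : T) : nat -> T :=
  fun j => if j == i then x else e j.

Fixpoint sat (M : LHA_structure) (e : nat -> M) (f : formula) : Prop :=
  match f with
  | FEq s t => teval e s = teval e t
  | FNot g => ~ sat e g
  | FAnd g h => sat e g /\ sat e h
  | FOr g h => sat e g \/ sat e h
  | FImp g h => sat e g -> sat e h
  | FAll i g => forall x : M, sat (upd e i x) g
  | FEx i g => exists x : M, sat (upd e i x) g
  end.

(* For a sentence the assignment e is irrelevant, structures being nonempty. *)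
Definition models (M : LHA_structure) (f : formula) : Prop :=
  forall e : nat -> M, sat e f.

Definition elementarily_equivalent (M N : LHA_structure) : Prop :=
  forall f : formula, sentence f -> (models M f <-> models N f).

Definition closed_under_ops (M : LHA_structure) (U : set M) : Prop :=
  [/\ U (bot M), U (top M),
      forall a b, U a -> U b -> U (meet a b),
      forall a b, U a -> U b -> U (join a b) &
      forall a b, U a -> U b -> U (imp a b)].

Section Substructure.
Variables (M : LHA_structure) (U : set M) (cU : closed_under_ops U).

Definition sub_bot : U :=
  exist _ (bot M) (mem_set (let: And5 h _ _ _ _ := cU in h)).
Definition sub_top : U :=
  exist _ (top M) (mem_set (let: And5 _ h _ _ _ := cU in h)).
Definition sub_meet (a b : U) : U :=
  exist _ (meet (val a) (val b))
    (mem_set (let: And5 _ _ h _ _ := cU in h _ _ (set_valP a) (set_valP b))).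
Definition sub_join (a b : U) : U :=
  exist _ (join (val a) (val b))
    (mem_set (let: And5 _ _ _ h _ := cU in h _ _ (set_valP a) (set_valP b))).
Definition sub_imp (a b : U) : U :=
  exist _ (imp (val a) (val b))
    (mem_set (let: And5 _ _ _ _ h := cU in h _ _ (set_valP a) (set_valP b))).

Definition substructure : LHA_structure :=
  MkLHA sub_bot sub_top sub_meet sub_join sub_imp.

Definition elementary_substructure : Prop :=
  forall (f : formula) (e : nat -> substructure),
    sat e f <-> sat (M := M) (fun i => val (e i)) f.

End Substructure.

Definition generated (M : LHA_structure) (G : set M) : set M :=
  smallest (@closed_under_ops M) G.

Lemma generated_closed (M : LHA_structure) (G : set M) :
  closed_under_ops (generated G).
Proof.
split=> [A [[]] | A [[]] | a b ha hb A cA | a b ha hb A cA | a b ha hb A cA] //;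
by case: (cA) => -[_ _ h1 h2 h3] _; (apply: h1 || apply: h2 || apply: h3);
  [exact: ha | exact: hb].
Qed.

(* The points of K_n are coded by finitely branching trees labelled by subsets
   of {P_1, ..., P_n}, with 'I_n standing for {P_1, ..., P_n}. *)

Inductive tree (n : nat) : Type := Node of {set 'I_n} & seq (tree n).

Section TreeCode.
Variable n : nat.

Fixpoint tree_encode (t : tree n) : GenTree.tree {set 'I_n} :=
  let: Node b s := t in
  GenTree.Node 0 (GenTree.Leaf b :: [seq tree_encode u | u <- s]).

Fixpoint tree_decode (t : GenTree.tree {set 'I_n}) : option (tree n) :=
  if t is GenTree.Node _ (GenTree.Leaf b :: s)
  then Some (Node b (pmap tree_decode s)) else None.

Fixpoint tree_encodeK (t : tree n) : tree_decode (tree_encode t) = Some t.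
Proof.
case: t => b s /=; congr (Some (Node b _)).
by elim: s => //= t s ->; rewrite tree_encodeK.
Qed.

Fixpoint tree_size (t : tree n) : nat :=
  let: Node _ s := t in (sumn [seq tree_size u | u <- s]).+1.

End TreeCode.

HB.instance Definition _ n := Countable.copy (tree n) (pcan_type (@tree_encodeK n)).

Section Stages.
Local Open Scope fset_scope.
Variable n : nat.
Implicit Types (b : {set 'I_n}) (w v : tree n) (Y A B : {fset tree n}).

(* w_{b,Y}; the list underlying an {fset _} is canonical, so that distinct
   pairs (b, Y) give distinct trees. *)
Definition point b Y : tree n := Node b (enum_fset Y).

Definition tval w : {set 'I_n} := let: Node b _ := w in b.
Definition tbelow w : seq (tree n) := let: Node _ s := w in s.
Definition tle w v : bool := (w \in tbelow v) || (w == v).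

Definition tdecreasing B Y : Prop :=
  Y `<=` B /\ forall w v, v \in Y -> w \in B -> tle w v -> w \in Y.

(* Conditions (i)-(iii) on (b, Y), with B = K_n^{d-1} and A = K_n^{d-2}. *)
Definition admissible A B b Y : Prop :=
  [/\ tdecreasing B Y /\ ~~ (Y `<=` A),
      forall w, w \in Y -> b \subset tval w &
      forall w, w \in B -> Y = [fset v in B | tle v w] -> b <> tval w].

Definition new_points A B : {fset tree n} :=
  [fset point b Y | b in [set: {set 'I_n}]%SET,
                    Y in [fset Y in fpowerset B | `[< admissible A B b Y >]]].

(* stage d is K_n^d. For d = 0 the only decreasing subset of K_n^{-1} is
   empty, and conditions (ii) and (iii) are vacuous. *)
Fixpoint stage (d : nat) : {fset tree n} :=
  match d with
  | 0 => [fset point b fset0 | b in [set: {set 'I_n}]%SET]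
  | d'.+1 => stage d' `|`
      new_points (if d' is d''.+1 then stage d'' else fset0) (stage d')
  end.

Definition Kset : set (tree n) := [set w | exists d, w \in stage d]%classic.

Lemma stageS d : stage d.+1 = stage d `|`
  new_points (if d is d'.+1 then stage d' else fset0) (stage d).
Proof. by []. Qed.

Lemma stage_decreasing d v w : v \in stage d -> w \in tbelow v -> w \in stage d.
Proof.
elim: d v w => [|d IH] v w.
  by case/imfsetP => b _ -> /=.
rewrite stageS in_fsetU; case/orP => [vd /(IH _ _ vd) wd|].
  by rewrite in_fsetU wd.
case/imfset2P => b _ [Y]; rewrite inE => /andP[/[!fpowersetE]/fsubsetP YB _] ->.
by move=> /YB wd; rewrite in_fsetU wd.
Qed.

Lemma tle_trans d u v w : w \in stage d -> tle u v -> tle v w -> tle u w.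
Proof.
elim: d u v w => [|d IH] u v w.
  by case/imfsetP => b _ -> uv /orP[|/eqP <-].
rewrite stageS in_fsetU; case/orP => [wd uv vw|]; first exact: IH uv vw.
case/imfset2P => b _ [Y]; rewrite !inE => /andP[_ /asboolP].
case=> -[[YB Ydec] _] _ _ -> uv /orP[/= vY|/eqP <-//]; apply/orP; left.
apply: (Ydec _ v) => //; case/orP: uv => [uv|/eqP ->].
  by apply: stage_decreasing uv; apply: (fsubsetP YB).
exact: (fsubsetP YB).
Qed.

Lemma tle_tval d w v : v \in stage d -> tle w v -> tval v \subset tval w.
Proof.
elim: d v w => [|d IH] v w.
  by case/imfsetP => b _ -> /orP[//|/eqP ->].
rewrite stageS in_fsetU; case/orP => [|]; first exact: IH.
case/imfset2P => b _ [Y]; rewrite inE => /andP[_ /asboolP].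
by case=> _ bY _ -> /orP[/bY //|/eqP ->].
Qed.

Lemma tle_size u v : tle u v -> (u == v) || (tree_size u < tree_size v).
Proof.
case/orP=> [|->//]; case: v => b s /= us; apply/orP; right; rewrite ltnS.
elim: s us => //= v s IH; rewrite inE => /orP[/eqP ->|/IH h].
  exact: leq_addr.
exact: leq_trans h (leq_addl _ _).
Qed.

End Stages.

Arguments Kset : clear implicits.

Definition K (n : nat) : Type := Kset n.

HB.instance Definition _ n := Choice.copy (K n) (Kset n).

Fact K_display : Order.disp_t. Proof. exact: Order.Disp tt tt. Qed.

Section KOrder.
Variable n : nat.

Definition Kle (w v : K n) : bool := tle (val w) (val v).

Lemma Kle_refl : reflexive Kle.
Proof. by move=> w; rewrite /Kle /tle eqxx orbT. Qed.

Lemma Kle_anti : antisymmetric Kle.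
Proof.
move=> w v /andP[/tle_size/orP[/eqP/val_inj //|h1]].
case/tle_size/orP=> [/eqP/val_inj //|h2].
by move: (ltn_trans h1 h2); rewrite ltnn.
Qed.

Lemma Kle_trans : transitive Kle.
Proof. by move=> v u w; case: (set_valP w) => d wd; apply: tle_trans wd. Qed.

HB.instance Definition _ :=
  Order.Le_isPOrder.Build K_display (K n) Kle_refl Kle_anti Kle_trans.

End KOrder.

Definition Kval (n : nat) (w : K n) : {set 'I_n} := tval (val w).

Section Heyting.
Variable n : nat.
Implicit Types a b c : set (K n).

Definition decreasing a : Prop :=
  forall w v : K n, (w <= v)%O -> a v -> a w.

Definition downset : Type := [set a : set (K n) | decreasing a].

Definition mk_downset a (da : decreasing a) : downset := exist _ a (mem_set da).

Definition himp a b : set (K n) :=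
  \bigcup_(c in [set c | decreasing c /\ c `<=` ~` a `|` b]) c.

Lemma decreasing0 : decreasing set0. Proof. by []. Qed.

Lemma decreasingT : decreasing setT. Proof. by []. Qed.

Lemma decreasingI a b : decreasing a -> decreasing b -> decreasing (a `&` b).
Proof.
by move=> da db w v wv [av bv]; split; [exact: da wv av | exact: db wv bv].
Qed.

Lemma decreasingU a b : decreasing a -> decreasing b -> decreasing (a `|` b).
Proof.
by move=> da db w v wv [/(da _ _ wv)|/(db _ _ wv)]; [left | right].
Qed.

Lemma decreasing_himp a b : decreasing (himp a b).
Proof.
by move=> w v wv [c [dc cab] cv]; exists c => //; exact: dc wv cv.
Qed.

Definition Fhat : LHA_structure :=
  @MkLHA downset
    (mk_downset decreasing0)
    (mk_downset decreasingT)
    (fun a b : downset => mk_downset (decreasingI (set_valP a) (set_valP b)))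
    (fun a b : downset => mk_downset (decreasingU (set_valP a) (set_valP b)))
    (fun a b : downset => mk_downset (@decreasing_himp (val a) (val b))).

Lemma Kval_decreasing (i : 'I_n) : decreasing [set w | i \in Kval w].
Proof.
move=> w v wv; case: (set_valP v) => d vd.
by apply: (fintype.subsetP (tle_tval vd wv)).
Qed.

Definition gen (i : 'I_n) : Fhat := mk_downset (@Kval_decreasing i).

Definition free_set : set Fhat := generated (range gen).

Lemma free_set_closed : closed_under_ops free_set.
Proof. exact: generated_closed. Qed.

(* F_n: by Bellissima's theorem this subalgebra is free on the g_i. *)
Definition F : LHA_structure := substructure free_set_closed.

End Heyting.

Arguments free_set : clear implicits.

(* Main.v *)
(* A tuple x in Fhat_n equips K_n with the valuation w |-> {i | w in x_i}. One
   first-order formula gamma(x) says that this valuation is irredundant. If it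
   holds in Fhat_n, the map sending w to the point with the valuation of w under
   x, and with the images of the points below w below it, is well defined, and is
   an order embedding of K_n into itself. It preserves every finite stage K_n^d,
   hence it is an automorphism of K_n, and pulling back along it gives an
   automorphism of Fhat_n taking the generators P to x. Since all principal
   downsets lie in F_n, gamma(P) holds in F_n. So if F_n satisfies phi(t(P)), then
   the sentence "gamma(x) and phi(t(x)) for some x" holds in F_n, hence in Fhat_n,
   and by the automorphism phi(t(P)) holds in Fhat_n. Apply this to phi and to its
   negation. *)

Require Import Defs.
From mathcomp Require Import all_boot.
From mathcomp Require Import all_order finmap.
From mathcomp Require Import zify.
From mathcomp Require Import mathcomp_extra boolp classical_sets.
Import Order.TTheory Defs.

Set Implicit Arguments.
Unset Strict Implicit.
Unset Printing Implicit Defensive.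

Local Open Scope classical_set_scope.

(** * First-order logic over L_HA *)

Section Logic.

Lemma teval_ext (M : LHA_structure) (e e' : nat -> M) t :
  {in tvars t, e =1 e'} -> teval e t = teval e' t.
Proof.
elim: t => //= [i|s IHs u IHu|s IHs u IHu|s IHs u IHu] ee'.
  by apply: ee'; rewrite inE.
all: by rewrite IHs ?IHu // => i it; apply: ee'; rewrite mem_cat it ?orbT.
Qed.

Lemma sat_ext (M : LHA_structure) f (e e' : nat -> M) :
  {in free_vars f, e =1 e'} -> sat e f <-> sat e' f.
Proof.
have split_in (s1 s2 : seq nat) (e1 e2 : nat -> M) : {in s1 ++ s2, e1 =1 e2} ->
    {in s1, e1 =1 e2} /\ {in s2, e1 =1 e2}.
  by move=> h; split=> i si; apply: h; rewrite mem_cat si ?orbT.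
have upd_in i x (s : seq nat) (e1 e2 : nat -> M) :
    {in [seq j <- s | j != i], e1 =1 e2} -> {in s, upd e1 i x =1 upd e2 i x}.
  by move=> h j js; rewrite /upd; case: (eqVneq j i) => // ji; apply: h; rewrite mem_filter ji.
elim: f e e' => //= [s u|g IH|g IHg h IHh|g IHg h IHh|g IHg h IHh|i g IH|i g IH]
    e e' ee'.
- by rewrite (@teval_ext M e e' s) 1?(@teval_ext M e e' u) // => j js;
    apply: ee'; rewrite mem_cat js ?orbT.
- by have := IH _ _ ee'; tauto.
- have [eg eh] := split_in _ _ _ _ ee'; have := IHg _ _ eg; have := IHh _ _ eh; tauto.
- have [eg eh] := split_in _ _ _ _ ee'; have := IHg _ _ eg; have := IHh _ _ eh; tauto.
- have [eg eh] := split_in _ _ _ _ ee'; have := IHg _ _ eg; have := IHh _ _ eh; tauto.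
- by split=> + x => /(_ x) /(IH _ _ (upd_in _ _ _ _ _ ee')).
- by split=> -[x /(IH _ _ (upd_in _ _ _ _ _ ee'))]; exists x.
Qed.

Fixpoint ex_closure_upto (m : nat) (f : formula) : formula :=
  if m is m'.+1 then ex_closure_upto m' (FEx m' f) else f.

(** Elementary equivalence compares sentences only; quantifying every variable up to the largest
    free one turns the satisfiability of [f] into a sentence. *)
Definition ex_closure f := ex_closure_upto (\max_(i <- free_vars f) i).+1 f.

Lemma ex_closure_sentence f : sentence (ex_closure f).
Proof.
have upto m g : (forall i, i \in free_vars g -> i < m) -> sentence (ex_closure_upto m g).
  elim: m g => [|m IH] g gm /=.
    rewrite /sentence; case: (free_vars g) gm => // i s /(_ i).
    by rewrite inE eqxx => /(_ isT).
  apply: IH => i /=; rewrite mem_filter => /andP[im /gm].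
  by rewrite ltnS leq_eqVlt (negPf im).
by apply: upto => i fi; rewrite ltnS; apply: leq_bigmax_seq.
Qed.

Lemma sat_ex_closure_upto (M : LHA_structure) m (e : nat -> M) f :
  sat e (ex_closure_upto m f) <->
  exists2 e', sat e' f & forall i, m <= i -> e' i = e i.
Proof.
elim: m f => [|m IH] f /=.
  split=> [|[e' + ee']]; first by exists e.
  by rewrite (_ : e' = e) //; apply/funext => i; exact: ee'.
rewrite IH /=; split=> -[e'].
  case=> x fx ee'; exists (upd e' m x) => // i mi.
  by rewrite /upd gtn_eqF // ee' // ltnW.
move=> fe' ee'; exists (upd e' m (e m)).
  exists (e' m); rewrite (_ : upd _ _ _ = e') //; apply/funext => j.
  by rewrite /upd; case: eqP => [->|].
move=> i; rewrite leq_eqVlt /upd => /orP[/eqP <-|mi]; first by rewrite eqxx.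
by rewrite gtn_eqF // ee'.
Qed.

Lemma models_ex_closure (M : LHA_structure) f :
  models M (ex_closure f) <-> exists e : nat -> M, sat e f.
Proof.
split=> [/(_ (fun=> bot M)) /sat_ex_closure_upto [e fe _]|[e fe] e0].
  by exists e.
apply/sat_ex_closure_upto; set m := _.+1.
exists (fun i => if i < m then e i else e0 i) => [|i]; last by rewrite leqNgt => /negPf ->.
apply/(sat_ext (e := e)) => // i fi; rewrite ifT // ltnS.
exact: leq_bigmax_seq.
Qed.

Definition hom (M N : LHA_structure) (h : M -> N) : Prop :=
  [/\ h (bot M) = bot N, h (top M) = top N,
      {morph h : a b / meet a b >-> meet a b},
      {morph h : a b / join a b >-> join a b} &
      {morph h : a b / imp a b >-> imp a b}].

Lemma teval_hom (M N : LHA_structure) (h : M -> N) (e : nat -> M) t :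
  hom h -> h (teval e t) = teval (h \o e) t.
Proof.
case=> h0 h1 hm hj hi.
by elim: t => //= s IHs u IHu; rewrite (hm, hj, hi) IHs IHu.
Qed.

Lemma sat_iso (M N : LHA_structure) (h : M -> N) (k : N -> M) (e : nat -> M) f :
  hom h -> cancel h k -> cancel k h -> sat e f <-> sat (h \o e) f.
Proof.
move=> hh hK kK.
have updE e1 i x : h \o upd e1 i x = upd (h \o e1) i (h x).
  by apply/funext => j; rewrite /= /upd; case: eqP.
elim: f e => /= [s u|g IH|g IHg g' IHg'|g IHg g' IHg'|g IHg g' IHg'|i g IH|i g IH] e.
- by rewrite -!teval_hom //; split=> [->//|/(can_inj hK)].
- by rewrite IH.
- by rewrite IHg IHg'.
- by rewrite IHg IHg'.
- by rewrite IHg IHg'.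
- split=> + x; first by move=> /(_ (k x)) /IH; rewrite updE kK.
  by move=> /(_ (h x)); rewrite -updE => /IH.
- split=> -[x]; first by move=> /IH; rewrite updE; exists (h x).
  by rewrite -[x]kK -updE => /IH; exists (k x).
Qed.

(** * Irredundance as a first-order formula *)

Definition fle s u := FEq (TMeet s u) s.
Definition fiff f g := FAnd (FImp f g) (FImp g f).
Definition fbig (g : nat -> formula) (m : nat) : formula :=
  foldr (fun i f => FAnd (g i) f) (FEq TTop TTop) (iota 0 m).

Lemma sat_fbig (M : LHA_structure) (e : nat -> M) g m :
  sat e (fbig g m) <-> forall i, i < m -> sat e (g i).
Proof.
rewrite /fbig; transitivity (forall i, i \in iota 0 m -> sat e (g i)); last first.
  by split=> h i; have := h i; rewrite mem_iota add0n.
elim: (iota 0 m) => //= a s IH; rewrite IH; split=> [[ga gs] i|gs].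
  by rewrite inE => /orP[/eqP ->|/gs].
by split=> [|i si]; apply: gs; rewrite inE ?eqxx ?si ?orbT.
Qed.

Definition lle (M : LHA_structure) (a b : M) : Prop := meet a b = a.

(* c is the greatest element strictly below a. In both F n and Fhat n this means
   that a is the set of points below some w in K_n and c = a minus {w}. *)
Definition pred_of (M : LHA_structure) (c a : M) : Prop :=
  [/\ lle c a, c <> a & forall b, lle b a -> b = a \/ lle b c].

Definition same_type (M : LHA_structure) n (x : nat -> M) (a b : M) : Prop :=
  forall i, i < n -> lle a (x i) <-> lle b (x i).

(* Points of K_n with the same points below them are told apart by their
   valuation in x, and so is a point from its only lower cover. *)
Definition irredundant (M : LHA_structure) n (x : nat -> M) : Prop :=
  (forall a b c, pred_of c a -> pred_of c b -> same_type n x a b -> a = b) /\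
  (forall a c d, pred_of c a -> pred_of d c -> ~ same_type n x a c).

(** The third argument is the variable bound by the inner quantifier, to be chosen different from
    [a] and [c]. *)
Definition fpred_of (c a b : nat) : formula :=
  FAnd (fle (TVar c) (TVar a)) (FAnd (FNot (FEq (TVar c) (TVar a)))
    (FAll b (FImp (fle (TVar b) (TVar a))
      (FOr (FEq (TVar b) (TVar a)) (fle (TVar b) (TVar c)))))).

Definition fsame_type n N (a b : nat) : formula :=
  fbig (fun i => fiff (fle (TVar a) (TVar (N + i))) (fle (TVar b) (TVar (N + i)))) n.

(** The tuple x occupies the variables [N], ..., [N + n - 1], so bound variables start at [N + n].
    In each clause the letter that is not quantified in front, [d] and then [b], serves as the bound
    variable of [fpred_of]. *)
Definition firredundant n N : formula :=
  let a := N + n in let b := a.+1 in let c := b.+1 in let d := c.+1 in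
  FAnd
    (FAll a (FAll b (FAll c (FImp (fpred_of c a d)
       (FImp (fpred_of c b d) (FImp (fsame_type n N a b) (FEq (TVar a) (TVar b))))))))
    (FAll a (FAll c (FAll d (FImp (fpred_of c a b)
       (FImp (fpred_of d c b) (FNot (fsame_type n N a c))))))).

Lemma sat_fpred_of (M : LHA_structure) (e : nat -> M) c a b :
  b != a -> b != c -> sat e (fpred_of c a b) <-> pred_of (e c) (e a).
Proof.
move=> ba bc; rewrite /pred_of /=; split=> [[? [? h]]|[? ? h]].
  split=> // x; have := h x.
  by rewrite /upd eqxx ![_ == b]eq_sym (negPf ba) (negPf bc).
do 2?split=> //; move=> x; have := h x.
by rewrite /upd eqxx ![_ == b]eq_sym (negPf ba) (negPf bc).
Qed.

Lemma sat_fsame_type (M : LHA_structure) (e : nat -> M) n N a b :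
  sat e (fsame_type n N a b) <-> same_type n (fun i => e (N + i)) (e a) (e b).
Proof. by rewrite sat_fbig. Qed.

Lemma sat_firredundant (M : LHA_structure) (e : nat -> M) n N :
  sat e (firredundant n N) <-> irredundant n (fun i => e (N + i)).
Proof.
have same_typeE (x y : nat -> M) a b : (forall i, i < n -> x i = y i) ->
    same_type n x a b <-> same_type n y a b.
  by move=> xy; split=> h i ni; have := h i ni; rewrite xy.
set A := N + n.
have envE a b c (e3 := upd (upd (upd e A a) A.+1 b) A.+2 c) :
    [/\ e3 A = a, e3 A.+1 = b, e3 A.+2 = c & forall i, i < n -> e3 (N + i) = e (N + i)].
  by split=> [|||i ni]; rewrite /e3 /upd; do ?case: eqP => //; lia.
have envE' a c d (e3 := upd (upd (upd e A a) A.+2 c) A.+3 d) :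
    [/\ e3 A = a, e3 A.+2 = c, e3 A.+3 = d & forall i, i < n -> e3 (N + i) = e (N + i)].
  by split=> [|||i ni]; rewrite /e3 /upd; do ?case: eqP => //; lia.
(* These unfold one connective at a time, keeping [fpred_of] and [fsame_type] folded for their own
   lemmas. *)
have satI e1 f g : sat (M := M) e1 (FImp f g) = (sat e1 f -> sat e1 g) by [].
have satN e1 f : sat (M := M) e1 (FNot f) = (~ sat e1 f) by [].
have body1 a b c : sat (upd (upd (upd e A a) A.+1 b) A.+2 c)
    (FImp (fpred_of A.+2 A A.+3) (FImp (fpred_of A.+2 A.+1 A.+3)
      (FImp (fsame_type n N A A.+1) (FEq (TVar A) (TVar A.+1))))) <->
    (pred_of c a -> pred_of c b -> same_type n (fun i => e (N + i)) a b -> a = b).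
  have [Ea Eb Ec Ex] := envE a b c.
  rewrite !satI.
  rewrite !sat_fpred_of; try lia.
  by rewrite sat_fsame_type (same_typeE _ _ _ _ Ex) /= Ea Eb Ec.
have body2 a c d : sat (upd (upd (upd e A a) A.+2 c) A.+3 d)
    (FImp (fpred_of A.+2 A A.+1) (FImp (fpred_of A.+3 A.+2 A.+1)
      (FNot (fsame_type n N A A.+2)))) <->
    (pred_of c a -> pred_of d c -> ~ same_type n (fun i => e (N + i)) a c).
  have [Ea Eb Ec Ex] := envE' a c d.
  rewrite !satI satN.
  rewrite !sat_fpred_of; try lia.
  by rewrite sat_fsame_type (same_typeE _ _ _ _ Ex) /= Ea Eb Ec.
split=> -[h1 h2]; split=> a b c.
- exact/body1/h1.
- exact/body2/h2.
- exact/body1/h1.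
- exact/body2/h2.
Qed.

End Logic.

(** * The poset K_n *)

Section Stages.
Local Open Scope fset_scope.
Variable n : nat.
Implicit Types (b : {set 'I_n}) (w v u : tree n) (Y : {fset tree n}).

(** This is $K_n^{d-1}$, starting from the empty $K_n^{-1}$, which makes the base case of
    [realize_level] void. *)
Definition prestage d : {fset tree n} := if d is d'.+1 then stage n d' else fset0.

Lemma prestage_sub d : prestage d `<=` stage n d.
Proof. by case: d => [|d]; rewrite ?fsub0set // stageS fsubsetUl. Qed.

Lemma tbelow_size u w : u \in tbelow w -> tree_size u < tree_size w.
Proof.
case: w => b s /= us; rewrite ltnS.
elim: s us => //= v s IH; rewrite inE => /orP[/eqP ->|/IH h]; first exact: leq_addr.
exact: leq_trans h (leq_addl _ _).
Qed.

(** Condition (iii) survives the passage to later stages: as [Y] lies in the earlier stage, a [Y]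
    generated by [v] among the later points is also generated by [v] among the earlier ones. *)
Lemma stage_inv d w : w \in stage n d -> exists b Y,
  [/\ w = point b Y, Y `<=` prestage d &
      forall v, v \in Y -> (forall u, u \in Y <-> (u \in prestage d) && tle u v) -> b <> tval v].
Proof.
elim: d w => [|d IH] w.
  by case/imfsetP => b _ ->; exists b, fset0; split=> //; apply: fsub0set.
rewrite stageS in_fsetU => /orP[wd|].
  have [b [Y [-> Yd irr]]] := IH _ wd; exists b, Y; split=> //.
    exact: fsubset_trans Yd (prestage_sub d).
  move=> v vY h; apply: irr => // u; split=> [uY|/andP[ud uv]].
    by rewrite (fsubsetP Yd) //=; have /h/andP[] := uY.
  by apply/h; rewrite uv (fsubsetP (prestage_sub d)).
case/imfset2P => b _ [Y]; rewrite !inE => /andP[_ /asboolP].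
case=> -[[YB _] _] _ irr ->; exists b, Y; split=> // v vY h.
apply: irr; first exact: (fsubsetP YB).
by apply/fsetP => u; rewrite !inE /=; apply/idP/idP => /h.
Qed.

(** Condition (i) also asks that [Y] reach outside $K_n^{d-2}$. Induction on [d] arranges this: if
    [Y] lies inside the previous stage, the point was added earlier. *)
Lemma point_stage d b Y : Y `<=` prestage d ->
  (forall w v, v \in Y -> w \in stage n d -> tle w v -> w \in Y) ->
  (forall w, w \in Y -> b \subset tval w) ->
  (forall v, v \in Y -> (forall u, u \in Y -> tle u v) -> b <> tval v) ->
  point b Y \in stage n d.
Proof.
move=> + + Yb Yirr; elim: d => [|d IH] Yd Ydec.
  have -> : Y = fset0 by apply/eqP; rewrite -fsubset0.
  by apply/imfsetP; exists b => //=; rewrite finset.in_setT.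
rewrite stageS in_fsetU; have [Yd'|Yd'] := boolP (Y `<=` prestage d).
  rewrite IH // => w v vY wd; apply: Ydec => //.
  exact: (fsubsetP (prestage_sub d.+1)).
apply/orP; right; apply/imfset2P; exists b; first by rewrite inE.
exists Y => //; rewrite !inE /= fpowersetE Yd /=; apply/asboolP; split=> //.
  split=> //; split=> // w v vY wd; apply: Ydec => //.
  exact: (fsubsetP (prestage_sub d.+1)).
move=> w wd YE; apply: Yirr; first by rewrite YE !inE wd /= /tle eqxx orbT.
by move=> u; rewrite {1}YE !inE => /andP[].
Qed.

End Stages.

(** * Levels, extensionality and construction of points *)

Section Points.
Variable n : nat.
Implicit Types (u v w : K n).

Definition mkK (t : tree n) (h : Kset n t) : K n := exist _ t (mem_set h).

Definition in_level d w : Prop := val w \in prestage n d.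

Lemma ltK w v : (w < v)%O = (val w \in tbelow (val v)).
Proof.
rewrite lt_neqAle; apply/idP/idP => [/andP[wv]|wv].
  by case/orP => // /eqP/val_inj wv'; rewrite wv' eqxx in wv.
apply/andP; split; last by apply/orP; left.
by apply: contraTneq (tbelow_size wv) => ->; rewrite ltnn.
Qed.

Lemma ltK_ind (P : K n -> Prop) :
  (forall w, (forall v, (v < w)%O -> P v) -> P w) -> forall w, P w.
Proof.
move=> IH w; have [m] := ubnP (tree_size (val w)); elim: m w => // m IHm w.
rewrite ltnS => wm; apply: IH => v; rewrite ltK => /tbelow_size vw.
exact: IHm (leq_trans vw wm).
Qed.

Lemma ltK_wf : well_founded (fun v w : K n => (v < w)%O).
Proof. by apply: ltK_ind => w IH; constructor. Qed.

Lemma in_level_exists w : exists d, in_level d w.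
Proof. by have [d wd] := set_valP w; exists d.+1. Qed.

Lemma in_levelS d w : in_level d w -> in_level d.+1 w.
Proof. exact/fsubsetP/prestage_sub. Qed.

(** The set [Y] of a point lies one stage lower; this drop in level drives the induction in
    [realize_level]. *)
Lemma in_level_lt d w v : (v < w)%O -> in_level d.+1 w -> in_level d v.
Proof.
rewrite ltK /in_level => vw /stage_inv[b [Y [wE Yd _]]].
by apply: (fsubsetP Yd); rewrite wE in vw.
Qed.

Lemma in_level_le d w v : (v <= w)%O -> in_level d w -> in_level d v.
Proof.
rewrite le_eqVlt => /orP[/eqP -> //|vw]; case: d => [//|d] wd.
exact/in_levelS/(in_level_lt vw).
Qed.

Lemma seq_lift (s : seq (tree n)) : {in s, forall t, Kset n t} ->
  exists s' : seq (K n), map val s' = s.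
Proof.
elim: s => [|t s IH] h; first by exists [::].
have [u us|s' <-] := IH; first by apply: h; rewrite inE us orbT.
have ht : Kset n t by apply: h; rewrite inE eqxx.
by exists (mkK ht :: s').
Qed.

Lemma level_seq d : exists s : seq (K n), forall w, w \in s <-> in_level d w.
Proof.
have [|s sE] := @seq_lift (enum_fset (prestage n d)).
  by case: d => [//|d] t td; exists d.
exists s => w; rewrite -(mem_map val_inj) sE; split=> h; exact: h.
Qed.

Lemma below_seq w : exists s : seq (K n), forall v, v \in s <-> (v < w)%O.
Proof.
have [d wd] := in_level_exists w; have [s sE] := level_seq d.
exists [seq v <- s | (v < w)%O] => v; rewrite mem_filter.
split=> [/andP[]//|vw]; rewrite vw; apply/sE.
exact: in_level_le (ltW vw) wd.
Qed.

(** The tree of a point is its label together with the canonical list of the points below it. *)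
Lemma K_ext w v : (forall u, (u < w)%O <-> (u < v)%O) -> Kval w = Kval v -> w = v.
Proof.
move=> h bE; apply: val_inj.
have [[|d] // wd] := in_level_exists w; have [[|e] // ve] := in_level_exists v.
have [b [Y [wE Yd _]]] := stage_inv wd; have [c [Z [vE Ze _]]] := stage_inv ve.
move: bE; rewrite /Kval wE vE /= => ->; congr point; apply/fsetP => t.
apply/idP/idP => tY.
- have [f tf] : Kset n t by exists d; apply: (fsubsetP (fsubset_trans Yd (prestage_sub _ _))).
  have := h (mkK (ex_intro _ f tf)).
  by rewrite !ltK wE vE => -[/(_ tY)].
- have [f tf] : Kset n t by exists e; apply: (fsubsetP (fsubset_trans Ze (prestage_sub _ _))).
  have := h (mkK (ex_intro _ f tf)).
  by rewrite !ltK wE vE => -[_ /(_ tY)].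
Qed.

(** This is condition (iii): the points below [w] form the decreasing set generated by [v]. *)
Lemma K_cover w v : (forall u, (u < w)%O <-> (u <= v)%O) -> Kval w <> Kval v.
Proof.
move=> h; have [[|d] // wd] := in_level_exists w.
have vw : (v < w)%O by apply/h.
have [b [Y [wE Yd irr]]] := stage_inv wd; rewrite /Kval wE /=; apply: irr.
  by move: vw; rewrite ltK wE.
have Kt t : t \in prestage n d -> Kset n t.
  by move=> td; exists d; apply: (fsubsetP (prestage_sub _ _)).
move=> t; split=> [tY|/andP[td tv]].
  have td := fsubsetP Yd _ tY; rewrite td /=.
  by apply: (h (mkK (Kt _ td))).1; rewrite ltK wE.
by have := (h (mkK (Kt _ td))).2 tv; rewrite ltK wE.
Qed.

Lemma K_mono w v : (v <= w)%O -> Kval w \subset Kval v.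
Proof. by have [d wd] := set_valP w; apply: tle_tval wd. Qed.

(** Conditions (i) to (iii) for a finite list of points; this supplies the values of [realize]. *)
Lemma K_point d (b : {set 'I_n}) (s : seq (K n)) :
  (forall v, v \in s -> in_level d v) ->
  (forall u v, (u <= v)%O -> v \in s -> u \in s) ->
  (forall v, v \in s -> b \subset Kval v) ->
  (forall v, v \in s -> (forall u, u \in s -> (u <= v)%O) -> b <> Kval v) ->
  exists w, [/\ in_level d.+1 w, Kval w = b & forall u, (u < w)%O <-> u \in s].
Proof.
move=> sd sdec sb sirr.
pose Y : {fset tree n} := seq_fset tt (map val s).
have YE t : t \in Y <-> exists2 v, v \in s & t = val v.
  by rewrite seq_fsetE; split=> [/mapP|h]; last exact/mapP.
have bY : point b Y \in stage n d.
  apply: point_stage => [|t _ /YE[v vs ->]|_ /YE[v vs ->]|_ /YE[v vs ->] h].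
  - by apply/fsubsetP => _ /YE[v vs ->]; exact: sd.
  - move=> td tv; apply/YE.
    by exists (mkK (ex_intro _ d td)) => //; apply: sdec vs.
  - exact: sb.
  - by apply: sirr => // u us; apply: h; apply/YE; exists u.
exists (mkK (ex_intro _ d bY)); split=> // u.
rewrite ltK; split=> [/YE[v vs /val_inj ->]//|us].
by apply/YE; exists u.
Qed.

End Points.

(** * Irredundant valuations on K_n *)

Section Realization.
Variables (n : nat) (vx : K n -> {set 'I_n}).
Hypothesis vx_mono : forall w v, (v <= w)%O -> vx w \subset vx v.
Hypothesis vx_ext : forall w v, (forall u, (u < w)%O <-> (u < v)%O) -> vx w = vx v -> w = v.
Hypothesis vx_cover : forall w v, (forall u, (u < w)%O <-> (u <= v)%O) -> vx w <> vx v.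

Definition realizes_step (w : K n) (f : forall v, (v < w)%O -> K n) (w' : K n) : Prop :=
  Kval w' = vx w /\ forall u, (u < w')%O <-> exists v (vw : (v < w)%O), f v vw = u.

(** Existence of a suitable point is not known at this stage, so [xget] carries the default [w];
    [realize_level] shows that a suitable point always exists. *)
Definition realize : K n -> K n :=
  Fix (@ltK_wf n) (fun=> K n) (fun w f => xget w [set w' | realizes_step f w']).

Lemma realizeE w : realize w =
  xget w [set w' | realizes_step (fun v (_ : (v < w)%O) => realize v) w'].
Proof.
rewrite {1}/realize Fix_eq // => v f g fg; congr xget; congr mkset.
congr realizes_step; apply: functional_extensionality_dep => u.
by apply: functional_extensionality_dep => uv; exact: fg.
Qed.

Definition realized w : Prop := Kval (realize w) = vx w /\
  forall u, (u < realize w)%O <-> exists2 v, (v < w)%O & realize v = u.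

(** Equal images have the same points below them; by induction these come from the same points, and
    [vx_ext] applies. The statement is relative to a level because [realize_level] uses injectivity
    on level [d] before [realized] is known on the next one. *)
Lemma realize_inj_level d : (forall w, in_level d w -> realized w) ->
  forall w v, in_level d w -> in_level d v -> realize w = realize v -> w = v.
Proof.
move=> dR; elim/ltK_ind => w IH v wd vd wv.
have [vw wlow] := dR _ wd; have [vv vlow] := dR _ vd.
apply: vx_ext; last by rewrite -vw -vv wv.
move=> u; split=> [uw|uv].
  have /vlow[t tv tu] : (realize u < realize v)%O by rewrite -wv; apply/wlow; exists u.
  by rewrite (IH _ uw t (in_level_le (ltW uw) wd) (in_level_le (ltW tv) vd) (esym tu)).
have /wlow[t tw tu] : (realize u < realize w)%O by rewrite wv; apply/vlow; exists u.
by rewrite -(IH _ tw u (in_level_le (ltW tw) wd) (in_level_le (ltW uv) vd)).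
Qed.

Lemma realize_level d w : in_level d w -> realized w /\ in_level d (realize w).
Proof.
elim: d w => [//|d IH] w wd.
have dR u : in_level d u -> realized u by case/IH.
have lowd u : (u < w)%O -> in_level d u by move=> uw; apply: in_level_lt wd.
have [s sE] := below_seq w.
have [|u v uv /mapP[t ts vE]|v /mapP[t /sE tw ->]|v /mapP[t /sE tw ->] h|] :=
    @K_point n d (vx w) (map realize s).
- by move=> v /mapP[t /sE/lowd/IH[_ td] ->].
- have tw := ts; move/sE: tw => tw; have [_ tlow] := dR _ (lowd _ tw).
  move: uv; rewrite vE le_eqVlt => /orP[/eqP ->|/tlow[r rt <-]]; apply: map_f => //.
  by apply/sE; apply: lt_trans rt tw.
- by have [-> _] := dR _ (lowd _ tw); apply: vx_mono; apply: ltW.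
(* Condition (iii): if all images lie below that of [t], injectivity on level [d] makes [t] the
   greatest point below [w], and [vx_cover] separates the valuations. *)
- have [-> tlow] := dR _ (lowd _ tw); apply: vx_cover => u.
  split=> [uw|ut]; last exact: le_lt_trans ut tw.
  have := h _ (map_f realize ((sE u).2 uw)).
  rewrite le_eqVlt => /orP[/eqP|/tlow[r rt ru]].
    by move/(realize_inj_level dR (lowd _ uw) (lowd _ tw)) => ->.
  rewrite -(realize_inj_level dR (lowd _ (lt_trans rt tw)) (lowd _ uw) ru).
  exact: ltW.
- move=> w' [w'd w'v w'low].
  (* By [K_ext] only [w'] meets the specification, so [xget] must pick it. *)
  have w'E : realize w = w'.
    rewrite realizeE; apply: xget_unique.
      split=> // u; rewrite w'low; split=> [/mapP[v /sE vw ->]|[v [vw <-]]].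
        by exists v, vw.
      by apply: map_f; apply/sE.
    move=> w2 [w2v w2low]; apply: K_ext; last by rewrite w2v.
    move=> u; rewrite w2low w'low; split=> [[v [vw <-]]|/mapP[v /sE vw ->]].
      by apply: map_f; apply/sE.
    by exists v, vw.
  rewrite /realized w'E; split=> //; split=> // u; rewrite w'low.
  split=> [/mapP[v /sE vw ->]|[v vw <-]]; first by exists v.
  by apply: map_f; apply/sE.
Qed.

Lemma realizedP w : realized w.
Proof. by have [d /realize_level[]] := in_level_exists w. Qed.

Lemma realize_inj : injective realize.
Proof.
move=> w v; have [d wd] := in_level_exists w; have [e ve] := in_level_exists v.
have up m k u : in_level m u -> in_level (m + k) u.
  by move=> um; elim: k => [|k IH]; rewrite ?addn0 // addnS; apply: in_levelS.
apply: (@realize_inj_level (d + e)); [|exact: up|by rewrite addnC; exact: up].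
by move=> u _; apply: realizedP.
Qed.

Lemma realize_le w v : (realize w <= realize v)%O = (w <= v)%O.
Proof.
rewrite !le_eqVlt (inj_eq realize_inj); congr orb.
apply/idP/idP => [|wv]; last by apply/(realizedP v).2; exists w.
by case/(realizedP v).2 => u uv /realize_inj <-.
Qed.

(* [realize] is an injective self-map of each finite level, hence onto. *)
Lemma realize_surj w : exists v, realize v = w.
Proof.
have [d wd] := in_level_exists w; have [s sE] := level_seq n d.
have fs (x : seq_sub s) : realize (ssval x) \in s.
  by apply/sE; apply: (realize_level _).2; apply/sE/(ssvalP x).
pose h (x : seq_sub s) := SeqSub (fs x).
have hinj : injective h.
  by move=> x y [] /realize_inj; apply: val_inj.
have ws : w \in s by apply/sE.
have := injF_onto hinj (SeqSub ws); case/codomP => x [] ->.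
by exists (ssval x).
Qed.

Lemma realize_bij : exists g, cancel realize g /\ cancel g realize.
Proof.
have [g gE] := boolp.choice realize_surj.
by exists g; split=> // w; apply: realize_inj.
Qed.

End Realization.

(** * Definability of the generators up to automorphism *)

Section Downsets.
Variable n : nat.
Implicit Types (a b : Fhat n) (w v : K n).

(** Kripke semantics of implication; from right to left the witness is the principal downset of
    [w]. *)
Lemma himpE (A B : set (K n)) w : himp A B w <-> forall v, (v <= w)%O -> A v -> B v.
Proof.
split=> [[C [dC CAB] Cw] v vw Av|h].
  by case: (CAB v (dC _ _ vw Cw)).
exists [set v | (v <= w)%O] => /=; last exact: lexx.
split=> [u v uv vw|v vw]; first exact: le_trans uv vw.
by case: (EM (A v)) => [/(h _ vw)|]; [right | left].
Qed.

Lemma lleE a b : lle a b <-> val a `<=` val b.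
Proof.
split=> [<- w []//|ab]; apply: val_inj => /=.
by apply/seteqP; split=> [w []//|w aw]; split=> //; exact: ab.
Qed.

Lemma downsetP a w v : (w <= v)%O -> val a v -> val a w.
Proof. exact: (set_valP a). Qed.

Definition pullback_of (f : K n -> K n) (f_le : {mono f : w v / (w <= v)%O}) a : Fhat n :=
  @mk_downset n (f @^-1` val a)
    (fun w v wv (av : val a (f v)) => @downsetP a (f w) (f v) (etrans (f_le w v) wv) av).

Lemma pullback_hom f g (f_le : {mono f : w v / (w <= v)%O}) : cancel g f -> hom (pullback_of f_le).
Proof.
move=> gK; split=> [||a b|a b|a b]; apply: val_inj => //=.
apply/seteqP; split=> w /himpE h; apply/himpE => v.
  by move=> vw; apply: h; rewrite f_le.
(* Surjectivity of [f] enters here: a point [v] below [f w] is written as [f (g v)]. *)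
by move=> vw; rewrite -[v]gK; apply: h; rewrite -f_le gK.
Qed.

Lemma pullbackK f g (f_le : {mono f : w v / (w <= v)%O}) (g_le : {mono g : w v / (w <= v)%O}) :
  cancel g f -> cancel (pullback_of f_le) (pullback_of g_le).
Proof.
move=> gK a; apply: val_inj; apply/seteqP.
by split=> w /=; rewrite gK.
Qed.

Definition down w : Fhat n := @mk_downset n [set v | (v <= w)%O]
  (fun u v uv vw => le_trans uv vw).

Definition below w : Fhat n := @mk_downset n [set v | (v < w)%O]
  (fun u v uv vw => le_lt_trans uv vw).

Lemma lle_down a w : lle (down w) a <-> val a w.
Proof.
rewrite lleE; split=> [h|aw v /= vw]; first exact/h/lexx.
exact: downsetP aw.
Qed.

Lemma pred_of_down w : pred_of (below w) (down w).
Proof.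
split.
- by apply/lleE => v; apply: ltW.
- by move/(congr1 (fun a : Fhat n => val a w)) => /= E; have : (w < w)%O; [rewrite E|rewrite ltxx].
- move=> b /lleE bw; have [bww|nbw] := EM (val b w).
    left; apply: val_inj; apply/seteqP; split=> // v /= vw; exact: downsetP bww.
  right; apply/lleE => v bv /=; rewrite lt_neqAle bw // andbT.
  by apply/eqP => vw; rewrite -vw in nbw.
Qed.

(* An element with a greatest element strictly below it is principal, as soon as
   the structure contains all principal downsets; this applies to F n. *)
Lemma pred_ofP (M : LHA_structure) (j : M -> Fhat n) (c a : M) :
  injective j -> {morph j : x y / meet x y >-> meet x y} ->
  (forall w, exists x, j x = down w) -> pred_of c a ->
  exists w, j a = down w /\ j c = below w.
Proof.
move=> jinj jm jd [ca nca cmax].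
have jle x y : lle x y <-> lle (j x) (j y).
  by rewrite /lle -jm; split=> [->//|/jinj].
have [w aw ncw] : exists2 w, val (j a) w & ~ val (j c) w.
  apply: contrapT => h; apply: nca; apply: jinj; apply: val_inj; apply/seteqP.
  split; first by apply/lleE/jle.
  by move=> w aw; apply: contrapT => ncw; apply: h; exists w.
(* As [down v] is in the image of [j], the maximality of [c] applies to it. *)
have key v : val (j a) v -> j a = down v \/ val (j c) v.
  move=> av; have [x xE] := jd v.
  have xa : lle x a by apply/jle; rewrite xE; apply/lle_down.
  have [xa'|/jle] := cmax _ xa; first by left; rewrite -xE xa'.
  by rewrite xE => /lle_down; right.
have [aE|//] := key _ aw; exists w; split=> //.
apply: val_inj; apply/seteqP; split=> v /=.
  move=> cv; rewrite lt_neqAle; apply/andP; split.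
    by apply/eqP => vw; rewrite vw in cv.
  have /jle/lleE/(_ _ cv) := ca; by rewrite aE.
move=> vw; case: (key v) => //; first by rewrite aE /=; exact: ltW.
rewrite aE => /(congr1 (fun a : Fhat n => val a w)) /= E.
have : (w <= v)%O by rewrite -E /=.
by rewrite lt_geF.
Qed.

End Downsets.

(** * Principal downsets belong to the free algebra *)

Section Principal.
Variable n : nat.
Implicit Types (A B : set (K n)) (u v w : K n).

Definition in_free A : Prop := exists2 a, free_set n a & val a = A.

Lemma in_freeI A B : in_free A -> in_free B -> in_free (A `&` B).
Proof.
have [_ _ cm _ _] := free_set_closed n.
by case=> a aF <- [b bF <-]; exists (meet a b) => //; apply: cm.
Qed.

Lemma in_free_imp A B : in_free A -> in_free B ->
  in_free [set w | forall v, (v <= w)%O -> A v -> B v].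
Proof.
have [_ _ _ _ ci] := free_set_closed n.
case=> a aF <- [b bF <-]; exists (imp a b); first exact: ci.
by apply/seteqP; split=> w h; apply/himpE.
Qed.

Lemma in_free_all (I : eqType) (s : seq I) (A : I -> set (K n)) :
  (forall i, i \in s -> in_free (A i)) ->
  in_free [set w | forall i, i \in s -> A i w].
Proof.
have [_ cT _ _ _] := free_set_closed n.
elim: s => [|i s IH] h.
  by exists (top (Fhat n)) => //; apply/seteqP; split=> // w _ i.
have -> : [set w | forall j, j \in i :: s -> A j w] =
          A i `&` [set w | forall j, j \in s -> A j w].
  apply/seteqP; split=> w /=.
    by move=> hw; split=> [|j js]; apply: hw; rewrite inE ?eqxx ?js ?orbT.
  by case=> Ai hw j; rewrite inE => /orP[/eqP ->|/hw].
apply: in_freeI; first by apply: h; rewrite inE eqxx.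
by apply: IH => j js; apply: h; rewrite inE js orbT.
Qed.

Lemma in_free_ex (I : eqType) (s : seq I) (A : I -> set (K n)) :
  (forall i, i \in s -> in_free (A i)) ->
  in_free [set w | exists2 i, i \in s & A i w].
Proof.
have [c0 _ _ cj _] := free_set_closed n.
elim: s => [|i s IH] h.
  by exists (bot (Fhat n)) => //; apply/seteqP; split=> // w [].
have [a aF aE] : in_free (A i) by apply: h; rewrite inE eqxx.
have [|b bF bE] := IH; first by move=> j js; apply: h; rewrite inE js orbT.
exists (join a b); first exact: cj.
apply/seteqP; split=> w /=; rewrite aE bE.
  by case=> [?|[j js ?]]; [exists i | exists j] => //; rewrite inE ?eqxx ?js ?orbT.
by case=> j; rewrite inE => /orP[/eqP -> ?|js ?]; [left | right; exists j].
Qed.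

Lemma in_free_gen (i : 'I_n) : in_free [set w | i \in Kval w].
Proof. by exists (gen i) => // A [_]; apply; exists i. Qed.

Lemma in_free_below w : (forall v, (v < w)%O -> free_set n (down v)) ->
  in_free [set v | (v < w)%O].
Proof.
move=> h; have [s sE] := below_seq w.
have -> : [set v | (v < w)%O] = [set v | exists2 u, u \in s & (v <= u)%O].
  apply/seteqP; split=> v /=; first by move=> vw; exists v => //; apply/sE.
  by case=> u /sE uw vu; apply: le_lt_trans uw.
by apply: (@in_free_ex _ s (fun u v => (v <= u)%O)) => u /sE/h; exists (down u).
Qed.

(** By induction along the order, [down w] is the meet of the generators in [Kval w], of the
    implication from the join of the other generators to [below w], and, for each [v] below [w], of
    ([down v] → [below v]) → [below w]. All meets and joins are finite since [w] has finitely many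
    points below it. *)
Lemma down_free w : free_set n (down w).
Proof.
elim/ltK_ind: w => w IH; have [s sE] := below_seq w.
have lowF := in_free_below IH.
(* A point minimal in A1 `&` A2 `&` A3 outside [set v | v < w] has the same
   valuation and the same points below it as w, and nothing can lie above it. *)
pose A1 := [set u | forall i, i \in enum (Kval w) -> i \in Kval u].
pose A2 := [set u | forall v, (v <= u)%O ->
  (exists2 i, i \in enum (~: Kval w) & i \in Kval v) -> (v < w)%O].
pose A3 := [set u | forall v, v \in s -> forall t, (t <= u)%O ->
  (forall r, (r <= t)%O -> (r <= v)%O -> (r < v)%O) -> (t < w)%O].
have : in_free ((A1 `&` A2) `&` A3).
  do ?apply: in_freeI.
  - by apply: (@in_free_all _ _ (fun i u => i \in Kval u)) => i _; apply: in_free_gen.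
  - apply: (@in_free_imp [set v | exists2 i, i \in enum (~: Kval w) & i \in Kval v]) => //.
    by apply: (@in_free_ex _ _ (fun i u => i \in Kval u)) => i _; apply: in_free_gen.
  - apply: (@in_free_all _ s (fun v u => forall t, (t <= u)%O ->
      (forall r, (r <= t)%O -> (r <= v)%O -> (r < v)%O) -> (t < w)%O)) => v /sE vw.
    apply: (@in_free_imp [set t | forall r, (r <= t)%O -> (r <= v)%O -> (r < v)%O]) => //.
    apply: (@in_free_imp [set r | (r <= v)%O]); first by exists (down v) => //; apply: IH.
    by apply: in_free_below => u uv; apply: IH; apply: lt_trans vw.
case=> a aF aE; suff -> : down w = a by [].
apply: val_inj; rewrite aE; apply/seteqP; split=> u /=.
  move=> uw; split; first split.
  - by move=> i; rewrite mem_enum; apply: (fintype.subsetP (K_mono uw)).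
  - move=> v vu [i]; rewrite mem_enum inE => iw iv.
    rewrite lt_neqAle (le_trans vu uw) andbT.
    by apply: contraNneq iw => <-.
  - move=> v /sE vw t tu h; rewrite lt_neqAle (le_trans tu uw) andbT.
    apply/eqP => tw; have := h v; rewrite tw (ltW vw) lexx => /(_ isT isT).
    by rewrite ltxx.
case=> -[a1 a2] a3.
(* [A1] and [A2] give the two inclusions between the valuations, [A3] the points below. *)
have top v : (v <= u)%O -> ~~ (v < w)%O -> Kval v = Kval w /\ forall t, (t < w)%O -> (t <= v)%O.
  move=> vu nvw; split.
    apply/eqP; rewrite finset.eqEsubset; apply/andP; split; last first.
      apply: fintype.subset_trans (K_mono vu).
      by apply/fintype.subsetP => i iw; apply: a1; rewrite mem_enum.
    apply/fintype.subsetP => i iv; apply: contraNT nvw => iw; apply: (a2 v) => //.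
    by exists i => //; rewrite mem_enum inE.
  move=> t tw; apply: contraNT nvw => ntv; apply: (a3 t) => //; first exact/sE.
  move=> r rv rt; rewrite lt_neqAle rt andbT.
  by apply: contraNneq ntv => <-.
(* The claim is generalized to all [v] below [u], so that induction covers the points below [v]. *)
elim/ltK_ind: {-2}u (lexx u) => v IHv vu.
have below_w t : (t < v)%O -> (t <= w)%O.
  by move=> tv; apply: IHv => //; apply: le_trans vu; apply: ltW.
have [/ltW //|nvw] := boolP (v < w)%O.
have [vE wv] := top _ vu nvw.
(* A [v] above [w] would have [w] as its only lower cover, with the same valuation; [K_cover]
   excludes this. *)
have [wltv|nwv] := boolP (w < v)%O.
  case: (@K_cover _ v w) => // t; split; first exact: below_w.
  by move=> tw; apply: le_lt_trans wltv.
suff -> : v = w by [].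
apply: K_ext => // t; split=> tx; rewrite lt_neqAle.
  by rewrite below_w // andbT; apply: contraNneq nwv => <-.
by rewrite wv // andbT; apply: contraNneq nvw => <-.
Qed.

End Principal.

(** * Transfer of formulas from the free algebra to its completion *)

Section Main.
Variable n : nat.

(** Variable [N + i] denotes the generator $g_i$; the values at other indices only have to lie in
    the free algebra. *)
Definition gen_env (N k : nat) : Fhat n :=
  if insub (k - N) is Some i then gen i else bot (Fhat n).

Lemma gen_envE N (i : 'I_n) : gen_env N (N + i) = gen i.
Proof. by rewrite /gen_env addKn valK. Qed.

Lemma gen_env_free N k : free_set n (gen_env N k).
Proof.
rewrite /gen_env; case: insub => [i|]; last by have [] := free_set_closed n.
by move=> A [_]; apply; exists i.
Qed.

(** The values of such terms contain the generators and are closed under the operations. Starting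
    the variables at [N] keeps them apart from those of the formula to be transferred. *)
Lemma free_term N (a : Fhat n) : free_set n a -> exists t,
  (forall k, k \in tvars t -> exists i : 'I_n, k = N + i) /\ a = teval (gen_env N) t.
Proof.
move/(_ [set b | exists t, (forall k, k \in tvars t -> exists i : 'I_n, k = N + i) /\
  b = teval (gen_env N) t]); apply; split; last first.
  move=> _ [i _ <-]; exists (TVar (N + i)); rewrite /= gen_envE; split=> // k.
  by rewrite inE => /eqP ->; exists i.
split=> [||_ _ [s [sv ->]] [t [tv ->]]|_ _ [s [sv ->]] [t [tv ->]]|_ _ [s [sv ->]] [t [tv ->]]].
- by exists TBot.
- by exists TTop.
- by exists (TMeet s t); split=> // k; rewrite mem_cat => /orP[/sv|/tv].
- by exists (TJoin s t); split=> // k; rewrite mem_cat => /orP[/sv|/tv].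
- by exists (TImp s t); split=> // k; rewrite mem_cat => /orP[/sv|/tv].
Qed.

Definition mkF (a : Fhat n) (aF : free_set n a) : F n := exist _ a (mem_set aF).

Lemma val_hom : hom (fun a : F n => val a).
Proof. by []. Qed.

(** By [pred_ofP], which applies since [down_free] puts all principal downsets in [F n], the
    elements in question are principal. Equal types then mean equal valuations, and the two clauses
    become [K_ext] and [K_cover]. *)
Lemma irredundant_gen (x : nat -> F n) :
  (forall i : 'I_n, val (x i) = gen i) -> irredundant n x.
Proof.
move=> xE.
have cov := @pred_ofP n (F n) (fun a => val a) _ _ val_inj (fun _ _ => erefl)
  (fun w => ex_intro _ (mkF (down_free w)) erefl).
have typ (a b : F n) w v : val a = down w -> val b = down v -> same_type n x a b ->
    Kval w = Kval v.
  move=> aw bv ab; apply/setP => i.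
  have le (c : F n) u : val c = down u -> lle c (x i) <-> i \in Kval u.
    move=> cu; have /= <- := lle_down (gen i) u; rewrite -xE -cu /lle; split=> h; last exact: val_inj.
    exact: (congr1 (fun a : F n => val a) h).
  apply/idP/idP => [/(le _ _ aw)|/(le _ _ bv)] h; [apply/(le _ _ bv)|apply/(le _ _ aw)].
    by apply/ab.
  by apply/ab.
have belowE (w v u : K n) : below w = below v -> (u < w)%O <-> (u < v)%O.
  by move=> /(congr1 (fun a : Fhat n => val a u)) /= ->.
split=> [a b c /cov[w [aw cw]] /cov[v [bv cv]] ab|a c d /cov[w [aw cw]] /cov[v [cv dv]] ac].
  apply: val_inj; rewrite aw bv; congr down; apply: K_ext; last exact: typ ab.
  by move=> u; apply: belowE; rewrite -cw cv.
apply: (K_cover (w := w) (v := v)) (typ _ _ _ _ aw cv ac) => u.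
have /(congr1 (fun a : Fhat n => val a u)) /= -> // : below w = down v by rewrite -cw cv.
Qed.

(* The transferred sentence says: there are an irredundant tuple x and values y of
   the variables of f, each y_j being the term t_j(x), that satisfy f. The
   variable N + i stands for x_i. *)
Lemma sat_transfer f (e : nat -> F n) : elementarily_equivalent (F n) (Fhat n) ->
  sat e f -> sat (M := Fhat n) (fun i => val (e i)) f.
Proof.
move=> equiv ef; pose N := (\max_(i <- free_vars f) i).+1.
have fN i : i \in free_vars f -> i < N by move=> fi; rewrite ltnS; apply: leq_bigmax_seq.
have [t_ tE] := boolp.choice (fun j => free_term N (set_valP (e j))).
pose body := FAnd (firredundant n N) (FAnd f (fbig (fun j => FEq (TVar j) (t_ j)) N)).
have /(equiv _ (ex_closure_sentence body)) : models (F n) (ex_closure body).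
  apply/models_ex_closure.
  pose genF k : F n := mkF (gen_env_free N k).
  (* In the free algebra the witnesses are the given values below [N] and the generators from [N]
     on. *)
  exists (fun k => if k < N then e k else genF k); split; last split.
  - apply/sat_firredundant/irredundant_gen => i.
    by rewrite ltnNge leq_addr /= gen_envE.
  - by apply/(sat_ext (e := e)) => // i fi; rewrite fN.
  - apply/sat_fbig => j jN; apply: val_inj.
    rewrite [LHS]/= jN (teval_hom _ _ val_hom) (tE j).2.
    apply: teval_ext => k /(tE j).1[i ->].
    by rewrite /= ltnNge leq_addr.
case/models_ex_closure => e2 e2body.
have [/sat_firredundant[ext cover] [e2f /sat_fbig e2t]] : sat e2 (firredundant n N) /\
  sat e2 f /\ sat e2 (fbig (fun j => FEq (TVar j) (t_ j)) N) := e2body.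
pose vx w := [set i : 'I_n | `[< val (e2 (N + i)) w >]]%SET.
have vxE w i : i \in vx w <-> val (e2 (N + i)) w.
  by rewrite inE; split=> /asboolP.
have typ w v : vx w = vx v ->
    same_type n (fun i => e2 (N + i)) (down w) (down v).
  move=> wv i ni; rewrite !lle_down.
  by have := vxE w (Ordinal ni); have := vxE v (Ordinal ni); rewrite wv /=; tauto.
have vx_mono w v : (v <= w)%O -> vx w \subset vx v.
  move=> vw; apply/fintype.subsetP => i /vxE iw; apply/vxE; exact: downsetP iw.
(* Irredundance of x is applied to the principal downsets of [w] and [v], whose common predecessor
   is [below w]. *)
have vx_ext w v : (forall u, (u < w)%O <-> (u < v)%O) -> vx w = vx v -> w = v.
  move=> wv /typ h; have : down w = down v.
    apply: (ext _ _ (below w)) h; first exact: pred_of_down.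
    rewrite (_ : below w = below v); first exact: pred_of_down.
    by apply: val_inj; apply/seteqP; split=> u /= /wv.
  move/(congr1 (fun a : Fhat n => val a)) => /seteqP[/= wvs vws].
  by apply: le_anti; rewrite (wvs w (lexx w)) (vws v (lexx v)).
have vx_cover w v : (forall u, (u < w)%O <-> (u <= v)%O) -> vx w <> vx v.
  move=> wv /typ; apply: (cover _ _ (below v)); last exact: pred_of_down.
  rewrite (_ : down v = below w); first exact: pred_of_down.
  by apply: val_inj; apply/seteqP; split=> u /= /wv.
have f_le := realize_le vx_mono vx_ext vx_cover.
have [g [fK gK]] := realize_bij vx_mono vx_ext vx_cover.
have g_le : {mono g : w v / (w <= v)%O} by move=> w v; rewrite -f_le !gK.
have hh := pullback_hom f_le gK.
(* Pulling back along [realize] sends each $g_i$ to $x_i$, hence each $t_j(P)$ to $t_j(x)=y_j$, the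
   value of variable [j] in [e2]. *)
apply/(sat_iso _ _ hh (pullbackK f_le g_le gK) (pullbackK g_le f_le fK)).
apply/(sat_ext (e' := e2)) => // j /fN jN; rewrite [RHS](e2t _ jN) /=.
rewrite (tE j).2 teval_hom //; apply: (@teval_ext (Fhat n)) => k /(tE j).1[i ->] /=.
rewrite gen_envE; apply: val_inj; apply/seteqP; split=> w /=.
  by rewrite (realizedP vx_mono vx_ext vx_cover w).1 => /vxE.
by move/vxE; rewrite (realizedP vx_mono vx_ext vx_cover w).1.
Qed.

End Main.

Theorem proposition6p9 (n : nat) (hn : (1 <= n)%N)
    (equiv : elementarily_equivalent (F n) (Fhat n)) :
  elementary_substructure (free_set_closed n).
Proof.
move=> f e; split; first exact: sat_transfer.
move=> fe; apply: contrapT => /(sat_transfer (f := FNot f) equiv); exact.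
Qed.
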